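(* Let $r\ge2$, $\lambda$ a partition with $r$ parts (some possibly zero), $N\ge\lambda_1+r-1$, $\mathbf{z}\in(\mathbb{C}^\times)^r$, and $w\in W=S_r$. For an admissible state $\mathfrak{s}$ of the uncolored system $\mathfrak{S}_{\mathbf{z},\lambda}$, $\mathfrak{s}$ is the image under forgetting colors of an admissible state of the colored system $\mathfrak{S}_{\mathbf{z},\lambda,w}$ if and only if $w_0\,\omega\big(\mathfrak{T}(\mathfrak{s})'\big)=w$.
   Context: Grid: $r$ rows labeled $1,\dots,r$ top to bottom, $N+1$ columns labeled $N,\dots,0$ left to right; each vertex has left, top, right, bottom edges. Uncolored system $\mathfrak{S}_{\mathbf{z},\lambda}$: spins $\pm$ on edges; top boundary edges in columns $\lambda_k+r-k$ ($k=1,\dots,r$) are $-$, other top boundary edges $+$; left and bottom boundary edges $+$; right boundary edges $-$. A state is admissible if every vertex has (left, top, right, bottom) equal to one of $(+,+,+,+)$, $(-,-,-,-)$, $(-,+,-,+)$, $(-,+,+,-)$, $(+,-,-,+)$. Colored system $\mathfrak{S}_{\mathbf{z},\lambda,w}$: colors $c_1>\cdots>c_r$; an edge carries $+$ or a color. Top boundary edge in column $\lambda_k+r-k$ carries $c_k$, other top edges $+$; left and bottom boundary edges $+$; right boundary edge of row $k$ carries $c_{w^{-1}(k)}$. Admissible: every vertex has (left, top, right, bottom) of one of the forms $(+,+,+,+)$, $(c,d,\max(c,d),\min(c,d))$, $(c,+,c,+)$, $(c,+,+,c)$, $(+,c,c,+)$ with $c,d$ colors. Forgetting colors replaces each color by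 $-$. Tableau $\mathfrak{T}(\mathfrak{s})$: in an admissible uncolored state, the row of vertical edges just above row $i$ has exactly $r+1-i$ edges with spin $-$; let $A_{i,i}>\cdots>A_{i,r}$ be their column labels and $a_{i,j}=A_{i,j}-(r-j)$. Then $(a_{i,j})$ is a Gelfand–Tsetlin pattern with top row $\lambda$, and $\mathfrak{T}(\mathfrak{s})$ is the semistandard tableau with entries in $\{1,\dots,r\}$ such that for each $i$ the subtableau of entries $\le r+1-i$ has shape $(a_{i,i},\dots,a_{i,r})$. $T\mapsto T'$ is the Schützenberger (Lusztig) involution of the crystal $\mathcal{B}_\lambda$ of such tableaux. The map $\omega:\mathcal{B}_\lambda\to W$: let $J$ be the concatenation of the blocks $(r-m,\dots,r-1)$, $m=1,\dots,r-1$, of length $M=r(r-1)/2$. For $v$ let $b_1$ be maximal with $e_{J_1}^{b_1}v\ne0$, $b_2$ maximal with $e_{J_2}^{b_2}e_{J_1}^{b_1}v\neq 0$, etc. Put $\beta_{m,p}=b_{m(m-1)/2+p}$ ($1\le p\le m\le r-1$); $\beta_{m,p}$ is circled if $p=m$ and $\beta_{m,m}=0$, or $p<m$ and $\beta_{m,p}=\beta_{m,p+1}$. List, for $m=1,\dots,r-1$ and within each $m$ for $p=m,\dots,1$, the $s_p$ with $\beta_{m,p}$ circled, giving $(s_{j_1},\dots,s_{j_k})$; $\omega(v)=\Pi_{\mathrm{nd}}(s_{j_1},\dots,s_{j_k})$, where $\Pi_{\mathrm{nd}}()=1$, $\Pi_{\mathrm{nd}}(s_{i_1},\dots,s_{i_k})=s_{i_1}\pi$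 if $s_{i_1}\pi>\pi$ in Bruhat order and $\pi$ otherwise, $\pi=\Pi_{\mathrm{nd}}(s_{i_2},\dots,s_{i_k})$. $w_0$ is the longest element of $S_r$. *)

(* Defs.v *)
(* Rows, colors and points permuted by 'S_r are 0-based ordinals,
   so k : 'I_r stands for k + 1.  Tableau entries, crystal indices and indices
   of simple reflections are naturals with their usual 1-based values. *)
From mathcomp Require Import all_boot all_order all_fingroup all_algebra.
From mathcomp Require Export reals complex.

Set Implicit Arguments.
Unset Strict Implicit.
Unset Printing Implicit Defensive.

(* The grid has columns labelled N, ..., 0 from left to right, and j : 'I_N.+1
   is a label.  Row i of [vedge] is the row of vertical edges just above row i
   of vertices (row r: the bottom boundary).  Entry (i, j) of [hedge] is the
   horizontal edge to the right of column j in row i, so that (i, j.+1) is to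
   its left, (i, 0) is the right boundary and (i, N.+1) the left boundary. *)
Record state (E : Type) (r N : nat) := State {
  vedge : 'M[E]_(r.+1, N.+1);
  hedge : 'M[E]_(r, N.+2) }.

Section Edges.
Variables (E : Type) (r N : nat) (s : state E r N).

Definition left_edge (i : 'I_r) (j : 'I_N.+1) : E :=
  hedge s i (lift ord0 j).
Definition right_edge (i : 'I_r) (j : 'I_N.+1) : E :=
  hedge s i (widen_ord (leqnSn N.+1) j).
Definition top_edge (i : 'I_r) (j : 'I_N.+1) : E :=
  vedge s (widen_ord (leqnSn r) i) j.
Definition bottom_edge (i : 'I_r) (j : 'I_N.+1) : E :=
  vedge s (lift ord0 i) j.

End Edges.

Definition top_column r (lam : r.-tuple nat) (k : 'I_r) : nat :=
  tnth lam k + (r - k.+1).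

Variant spin := Plus | Minus.

Definition is_minus (x : spin) : bool := if x is Minus then true else false.

(* Edges in the order left, top, right, bottom. *)
Variant uncolored_vertex : spin -> spin -> spin -> spin -> Prop :=
  | Uncolored_a1 : uncolored_vertex Plus Plus Plus Plus
  | Uncolored_a2 : uncolored_vertex Minus Minus Minus Minus
  | Uncolored_b2 : uncolored_vertex Minus Plus Minus Plus
  | Uncolored_c1 : uncolored_vertex Minus Plus Plus Minus
  | Uncolored_c2 : uncolored_vertex Plus Minus Minus Plus.

Definition uncolored_state r N (lam : r.-tuple nat) (s : state spin r N)
    : Prop :=
  [/\ forall j, vedge s ord0 j =
        if [exists k, (j : nat) == top_column lam k] then Minus else Plus,
      forall i, hedge s i ord_max = Plus,
      forall j, vedge s ord_max j = Plus,
      forall i, hedge s i ord0 = Minus &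
      forall i j, uncolored_vertex (left_edge s i j) (top_edge s i j)
                                   (right_edge s i j) (bottom_edge s i j)].

(* [None] is the spin +, and [Some k] the color c_(k + 1).  As c_1 > ... > c_r,
   the larger of two colors is the one with the smaller index. *)
Definition max_color r (c d : 'I_r) : 'I_r := if c <= d then c else d.
Definition min_color r (c d : 'I_r) : 'I_r := if c <= d then d else c.

Variant colored_vertex r :
    option 'I_r -> option 'I_r -> option 'I_r -> option 'I_r -> Prop :=
  | Colored_a1 : colored_vertex None None None None
  | Colored_a2 c d : colored_vertex (Some c) (Some d)
                       (Some (max_color c d)) (Some (min_color c d))
  | Colored_b2 c : colored_vertex (Some c) None (Some c) None
  | Colored_c1 c : colored_vertex (Some c) None None (Some c)
  | Colored_c2 c : colored_vertex None (Some c) (Some c) None.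

Definition colored_state r N (lam : r.-tuple nat) (w : 'S_r)
    (t : state (option 'I_r) r N) : Prop :=
  [/\ forall j, vedge t ord0 j = [pick k | (j : nat) == top_column lam k],
      forall i, hedge t i ord_max = None,
      forall j, vedge t ord_max j = None,
      forall k, hedge t k ord0 = Some ((w^-1)%g k) &
      forall i j, colored_vertex (left_edge t i j) (top_edge t i j)
                                 (right_edge t i j) (bottom_edge t i j)].

Definition forget_color r (x : option 'I_r) : spin :=
  if x is Some _ then Minus else Plus.

Definition forget_colors r N (t : state (option 'I_r) r N) : state spin r N :=
  State (map_mx (@forget_color r) (vedge t)) (map_mx (@forget_color r) (hedge t)).

(* The list of rows from top to bottom; empty rows are allowed. *)
Definition tableau := seq (seq nat).

Section StateTableau.
Variables (r N : nat) (s : state spin r N).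

(* A_(i+1,i+1) > ... > A_(i+1,r) *)
Definition minus_columns (i : 'I_r.+1) : seq nat :=
  [seq val j | j <- rev (enum 'I_N.+1) & is_minus (vedge s i j)].

(* a_(i+1,i+1), ..., a_(i+1,r) *)
Definition gt_row (i : 'I_r.+1) : seq nat :=
  mkseq (fun t => nth 0 (minus_columns i) t - (r - (i + t).+1)) (r - i).

(* The shape of the subtableau of entries <= m, for m <= r. *)
Definition subshape (m : nat) : seq nat := gt_row (inord (r - m)).

(* Row k receives as many entries m as there are boxes in row k of the skew
   shape between consecutive subshapes. *)
Definition state_tableau : tableau :=
  mkseq (fun k => flatten
    [seq nseq (nth 0 (subshape m) k - nth 0 (subshape m.-1) k) m
      | m <- iota 1 r]) r.

End StateTableau.

(* Rows are read from left to right, starting from the bottom row. *)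
Definition row_word (T : tableau) : seq nat := flatten (rev T).

Definition tableau_of_word (sh : seq nat) (w : seq nat) : tableau :=
  rev (reshape (rev sh) w).

(* Signature rule: each i + 1 is an opening and each i a closing bracket.  The
   i + 1 in position p is unmatched iff every factor of w starting at p has
   more letters i + 1 than letters i. *)
Definition unmatched (i : nat) (w : seq nat) (p : nat) : bool :=
  (nth 0 w p == i.+1) &&
  all (fun n => count_mem i (take n (drop p w)) <
                count_mem i.+1 (take n (drop p w))) (iota 1 (size w - p)).

(* e_i turns the leftmost unmatched i + 1 into i; [None] is the 0 of the
   crystal. *)
Definition e_word (i : nat) (w : seq nat) : option (seq nat) :=
  let p := find (unmatched i w) (iota 0 (size w)) in
  if p < size w then Some (set_nth 0 w p i) else None.

Definition crystal_e (i : nat) (T : tableau) : option tableau :=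
  omap (tableau_of_word (shape T)) (e_word i (row_word T)).

Definition crystal_e_iter (i b : nat) (T : tableau) : option tableau :=
  iter b (obind (crystal_e i)) (Some T).

(* The largest b with e_i ^ b T != 0; it cannot exceed the number of boxes. *)
Definition crystal_eps (i : nat) (T : tableau) : nat :=
  \max_(b < (size (row_word T)).+1 | isSome (crystal_e_iter i b T)) b.

Definition e_max (i : nat) (T : tableau) : tableau :=
  odflt T (crystal_e_iter i (crystal_eps i T) T).

Fixpoint crystal_string (J : seq nat) (T : tableau) : seq nat :=
  if J is i :: J' then crystal_eps i T :: crystal_string J' (e_max i T) else [::].

(* Schensted row insertion *)
Fixpoint row_insert (T : tableau) (x : nat) : tableau :=
  if T is R :: T' then
    let k := find (ltn x) R in
    if k < size R then set_nth 0 R k x :: row_insert T' (nth 0 R k)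
    else rcons R x :: T'
  else [:: [:: x]].

Definition insertion_tableau (w : seq nat) : tableau :=
  foldl row_insert [::] w.

(* Schutzenberger's involution (evacuation) on tableaux with entries in
   {1, ..., r}: the insertion tableau of the reversed and complemented word.
   It satisfies e_i (T') = (f_(r - i) T)', i.e. it is Lusztig's involution. *)
Definition schutzenberger (r : nat) (T : tableau) : tableau :=
  insertion_tableau (rev [seq r.+1 - x | x <- row_word T]).

Section Permutations.
Variable r : nat.
Implicit Types u v : 'S_r.

(* The product uv with (uv)(x) = u(v(x)), which is v * u in MathComp. *)
Definition perm_comp u v : 'S_r := (v * u)%g.

Definition inversions u : nat :=
  #|[set ij : 'I_r * 'I_r | (ij.1 < ij.2) && (u ij.2 < u ij.1)]|.

Definition bruhat_step : rel 'S_r := fun u v =>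
  [exists i, exists j, v == perm_comp u (tperm i j)] &&
  (inversions u < inversions v).

Definition bruhat_lt : rel 'S_r := fun u v =>
  (u != v) && connect bruhat_step u v.

(* s_p exchanges p and p + 1, for 1 <= p < r. *)
Definition simple_refl (p : nat) : 'S_r :=
  if (insub p.-1, insub p) is (Some i, Some j) then tperm i j else 1%g.

Definition longest : 'S_r := perm (@rev_ord_inj r).

(* A list of simple reflections is given by their indices. *)
Definition Pi_nd (l : seq nat) : 'S_r :=
  foldr (fun p u =>
    let su := perm_comp (simple_refl p) u in if bruhat_lt u su then su else u)
    1%g l.

Definition J_word : seq nat :=
  flatten [seq iota (r - m) m | m <- iota 1 r.-1].

Section Omega.
Variable T : tableau.

Definition beta (m p : nat) : nat :=
  nth 0 (crystal_string J_word T) ((m * m.-1)./2 + p).-1.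

Definition circled (m p : nat) : bool :=
  if p == m then beta m m == 0 else beta m p == beta m p.+1.

Definition circled_refls : seq nat :=
  flatten [seq [seq p <- rev (iota 1 m) | circled m p] | m <- iota 1 r.-1].

Definition omega : 'S_r := Pi_nd circled_refls.

End Omega.
End Permutations.

(* Main.v *)
(* Colors are forced.  In each row of the grid the color sequence, read from left
   to right, is modified only at the vertices whose four edges are all -: if the
   (p + 1)-st path enters such a vertex from the top, the colors in positions p
   and p + 1 are sorted, which is the 0-Hecke action of s_p.  So the right
   boundary is w_0 times the nondescending product of the s_p over these
   vertices.

   It remains to see that they are the circled entries.  The string of a tableau
   depends only on its reading word up to Knuth moves, so T' may be replaced by
   the reversed complement of the word of T.  On that word, block m of the string
   acts on a pattern whose rows below m are those of a lowest weight element; the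
   brackets of the signature rule then match only between consecutive rows, which
   gives beta_(m,p) - beta_(m,p+1) = a_p - a'_(p+1), where a and a' are the rows
   of length m and m + 1 of the Gelfand-Tsetlin pattern of T.  The difference
   vanishes iff the p-th - below a row of the grid lies in the same column as the
   (p + 1)-st - above it. *)
Require Import Defs.
From mathcomp Require Import all_boot all_order all_fingroup all_algebra.
From mathcomp Require Import zify.

Set Implicit Arguments.
Unset Strict Implicit.
Unset Printing Implicit Defensive.

(** * The signature rule *)

Section Signature.
Variable i : nat.

(* The signature rule scanned from the right: c is the number of unmatched
   letters i to the right of the word. *)
Fixpoint closers (c : nat) (w : seq nat) : nat :=
  if w is x :: w' then
    if x == i then (closers c w').+1
    else if x == i.+1 then (closers c w').-1 else closers c w'
  else c.

Fixpoint eps_word (c : nat) (w : seq nat) : nat :=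
  if w is x :: w' then ((x == i.+1) && (closers c w' == 0)) + eps_word c w'
  else 0.

Fixpoint emax_word (c : nat) (w : seq nat) : seq nat :=
  if w is x :: w' then
    (if (x == i.+1) && (closers c w' == 0) then i else x) :: emax_word c w'
  else [::].

(** A suffix acts on what precedes it only through its number of unmatched letters [i], so
    signatures can be computed factor by factor. *)
Lemma closers_cat c w1 w2 : closers c (w1 ++ w2) = closers (closers c w2) w1.
Proof. by elim: w1 => //= x w1 ->. Qed.

Lemma eps_word_cat c w1 w2 :
  eps_word c (w1 ++ w2) = eps_word (closers c w2) w1 + eps_word c w2.
Proof. by elim: w1 => //= x w1 ->; rewrite closers_cat addnA. Qed.

Lemma emax_word_cat c w1 w2 :
  emax_word c (w1 ++ w2) = emax_word (closers c w2) w1 ++ emax_word c w2.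
Proof. by elim: w1 => //= x w1 ->; rewrite closers_cat. Qed.

(** Thus [closers 0 w] is the largest excess of letters [i] over letters [i.+1] in a prefix. The
    bound [d] varies in the induction: a leading [i] uses up one unit, a leading [i.+1] adds one. *)
Lemma closers0_leP w d :
  (forall n, count_mem i (take n w) <= d + count_mem i.+1 (take n w)) <->
  closers 0 w <= d.
Proof.
elim: w d => [|x w IH] d /=; first by split=> // _ n.
have neq : (i == i.+1) = false by lia.
case: (eqVneq x i) => [->|xi].
  case: d => [|d].
    by split=> // /(_ 1); rewrite /= take0 /= neq eqxx.
  rewrite ltnS -IH; split=> H n.
    by have := H n.+1; rewrite /= neq eqxx; lia.
  by case: n => [|n] //=; have := H n; rewrite /= neq eqxx; lia.
case: (eqVneq x i.+1) => [->|xi1].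
  have -> : ((closers 0 w).-1 <= d) = (closers 0 w <= d.+1) by lia.
  rewrite -IH; split=> H n.
    by have := H n.+1; rewrite /= [i.+1 == i]eq_sym neq eqxx; lia.
  by case: n => [|n] //=; have := H n; rewrite /= [i.+1 == i]eq_sym neq eqxx; lia.
rewrite -IH; split=> H n.
  by have := H n.+1; rewrite /= (negPf xi) (negPf xi1).
by case: n => [|n] //=; have := H n; rewrite /= (negPf xi) (negPf xi1).
Qed.

Lemma unmatched_head x w :
  unmatched i (x :: w) 0 = (x == i.+1) && (closers 0 w == 0).
Proof.
rewrite /unmatched drop0 subn0 [nth _ _ _]/= [size _]/=; case: eqP => // ->.
rewrite !andTb.
have neq : (i.+1 == i) = false by lia.
apply/idP/idP => [/allP H|].
  rewrite -leqn0 -closers0_leP => n.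
  have /H : (minn n (size w)).+1 \in iota 1 (size w).+1.
    by rewrite mem_iota; lia.
  rewrite /= neq eqxx; case: (leqP n (size w)) => Hn; first by lia.
  by rewrite take_size take_oversize; lia.
rewrite -leqn0 -closers0_leP => H; apply/allP => -[|n]; first by rewrite mem_iota.
by move=> _; have := H n; rewrite /= neq eqxx; lia.
Qed.

Lemma e_word_cons x w :
  e_word i (x :: w) =
  if (x == i.+1) && (closers 0 w == 0) then Some (i :: w)
  else omap (cons x) (e_word i w).
Proof.
rewrite /e_word [iota 0 _]/= [find _ (_ :: _)]/= unmatched_head.
case: (_ && _) => //=.
have -> : iota 1 (size w) = map S (iota 0 (size w)).
  by rewrite -[1]/(1 + 0) iotaDl.
rewrite find_map.
have -> : find (preim succn (unmatched i (x :: w))) (iota 0 (size w)) =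
          find (unmatched i w) (iota 0 (size w)) by apply: eq_find.
by rewrite ltnS; case: ifP.
Qed.

(** Changing the leftmost unmatched [i.+1] leaves the others unmatched. The clause on [closers]
    drives the induction: a matched letter further left stays matched, as one more closer stands to
    its right. *)
Lemma e_wordP w :
  if eps_word 0 w is n.+1 then
    exists w1, [/\ e_word i w = Some w1, eps_word 0 w1 = n,
                   emax_word 0 w1 = emax_word 0 w, size w1 = size w &
                   closers 0 w1 = (closers 0 w).+1]
  else e_word i w = None /\ emax_word 0 w = w.
Proof.
have neq : (i == i.+1) = false by lia.
elim: w => [|x w IH] //=; rewrite e_word_cons.
case: ifP => [/andP[/eqP-> /eqP cw]|H] /=.
  exists (i :: w); rewrite /= neq eqxx eqxx.
  by split=> //; rewrite cw; case: eqP => //; lia.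
rewrite add0n; case: (eps_word 0 w) IH => [[-> ->]|n [w1 [-> e1 m1 s1 c1]]] //.
exists (x :: w1); rewrite /= e1 m1 s1 c1 andbF /=.
split=> //.
case: ifP => // xi; case: ifP => // xi1.
by move: H; rewrite xi1 /=; lia.
Qed.

Lemma eps_word_size c w : eps_word c w <= size w.
Proof. by elim: w => //= x w IH; case: (_ && _) => /=; lia. Qed.

Lemma iter_e_word w b :
  isSome (iter b (obind (e_word i)) (Some w)) = (b <= eps_word 0 w).
Proof.
elim: b w => // b IH w; rewrite iterSr /=.
have := e_wordP w; case E: (eps_word 0 w) => [|n].
  by move=> [-> _]; elim: b {IH} => //= b; case: (iter _ _ _).
by move=> [w1 [-> <- _ _ _]]; rewrite IH.
Qed.

Lemma iter_e_word_eps w :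
  iter (eps_word 0 w) (obind (e_word i)) (Some w) = Some (emax_word 0 w).
Proof.
move E: (eps_word 0 w) => n; elim: n w E => [|n IH] w E; have := e_wordP w.
  by rewrite E => -[_ ->].
by rewrite E iterSr => -[w1 [/= -> e1 <- _ _]]; exact: IH.
Qed.

End Signature.

(** Since [e_word] preserves the length, cutting the new word by the shape of [T] loses no
    letter. *)
Lemma row_word_e i T : omap row_word (crystal_e i T) = e_word i (row_word T).
Proof.
rewrite /crystal_e; have := e_wordP i (row_word T).
case: eps_word => [[->]|n [w1 [-> _ _ sz _]]] //=.
congr Some; rewrite /row_word /tableau_of_word revK reshapeKr //.
by rewrite sz /row_word size_flatten /shape map_rev.
Qed.

Lemma row_word_e_iter i b T :
  omap row_word (crystal_e_iter i b T) =
  iter b (obind (e_word i)) (Some (row_word T)).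
Proof.
rewrite /crystal_e_iter; elim: b => //= b <-.
by case: (iter b _ _) => //= T1; rewrite row_word_e.
Qed.

Lemma crystal_epsE i T : crystal_eps i T = eps_word i 0 (row_word T).
Proof.
have isS b : isSome (crystal_e_iter i b T) = (b <= eps_word i 0 (row_word T)).
  by rewrite -iter_e_word -row_word_e_iter; case: crystal_e_iter.
apply/eqP; rewrite eqn_leq; apply/andP; split.
  by apply/bigmax_leqP => b; rewrite isS.
have lt : eps_word i 0 (row_word T) < (size (row_word T)).+1.
  by rewrite ltnS eps_word_size.
by apply: (leq_bigmax_cond (Ordinal lt)); rewrite isS.
Qed.

Lemma row_word_e_max i T : row_word (e_max i T) = emax_word i 0 (row_word T).
Proof.
rewrite /e_max crystal_epsE; have := row_word_e_iter i (eps_word i 0 (row_word T)) T.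
by rewrite iter_e_word_eps; case: crystal_e_iter => //= T1 [].
Qed.

Fixpoint word_string (J w : seq nat) : seq nat :=
  if J is i :: J' then eps_word i 0 w :: word_string J' (emax_word i 0 w)
  else [::].

Lemma crystal_stringE J T : crystal_string J T = word_string J (row_word T).
Proof.
by elim: J T => //= i J IH T; rewrite IH row_word_e_max crystal_epsE.
Qed.

(** * Knuth moves and Schensted insertion *)

(** The moves are oriented as row insertion performs them: in each of them a letter travels to the
    left. *)
Inductive knuth : seq nat -> seq nat -> Prop :=
  | knuth_refl w : knuth w w
  | knuth_trans w1 w2 w3 : knuth w1 w2 -> knuth w2 w3 -> knuth w1 w3
  | knuth_yzx u v x y z : x < y <= z ->
      knuth (u ++ [:: y; z; x] ++ v) (u ++ [:: y; x; z] ++ v)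
  | knuth_xzy u v x y z : x <= y < z ->
      knuth (u ++ [:: x; z; y] ++ v) (u ++ [:: z; x; y] ++ v).

Lemma knuth_cat a b w1 w2 : knuth w1 w2 -> knuth (a ++ w1 ++ b) (a ++ w2 ++ b).
Proof.
move=> H; elim: H a b => {w1 w2} [w|w1 w2 w3 _ H1 _ H2|u v x y z H|u v x y z H] a b.
- exact: knuth_refl.
- exact: knuth_trans (H1 a b) (H2 a b).
- rewrite !catA -!catA !(catA a); exact: knuth_yzx.
- rewrite !catA -!catA !(catA a); exact: knuth_xzy.
Qed.

Lemma knuth3_signature i c (p q : seq nat) x y z :
  (x < y <= z) && (p == [:: y; z; x]) && (q == [:: y; x; z]) ||
  (x <= y < z) && (p == [:: x; z; y]) && (q == [:: z; x; y]) ->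
  [/\ closers i c p = closers i c q, eps_word i c p = eps_word i c q &
      knuth (emax_word i c p) (emax_word i c q)].
Proof.
have K1 x' y' z' : x' < y' <= z' -> knuth [:: y'; z'; x'] [:: y'; x'; z'].
  exact: (@knuth_yzx [::] [::]).
have K2 x' y' z' : x' <= y' < z' -> knuth [:: x'; z'; y'] [:: z'; x'; y'].
  exact: (@knuth_xzy [::] [::]).
have KR := knuth_refl.
case/orP => /andP[/andP[H /eqP->] /eqP->] /=.
(* The three letters are not all equal, so at most two are [i.+1], and [c] matters only as 0, 1 or
   at least 2. The resulting words are equal or related by a move of either kind. *)
all: case: (eqVneq x i) => xi; case: (eqVneq x i.+1) => xi1;
 case: (eqVneq y i) => yi; case: (eqVneq y i.+1) => yi1;
 case: (eqVneq z i) => zi; case: (eqVneq z i.+1) => zi1; try (exfalso; lia);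
 case: c => [|[|c]] /=; rewrite ?(inj_eq succn_inj) /=; (split; [lia|lia|]);
 try (subst; try exact: KR; by [apply: K1; lia | apply: K2; lia]).
Qed.

Lemma knuth_signature i w1 w2 : knuth w1 w2 ->
  [/\ closers i 0 w1 = closers i 0 w2, eps_word i 0 w1 = eps_word i 0 w2 &
      knuth (emax_word i 0 w1) (emax_word i 0 w2)].
Proof.
elim=> {w1 w2} [w|w1 w2 w3 _ [-> -> k1] _ [-> -> k2]|u v x y z H|u v x y z H].
- by split=> //; exact: knuth_refl.
- by split=> //; exact: knuth_trans k1 k2.
- have [|c e k] := @knuth3_signature i (closers i 0 v) [:: y; z; x] [:: y; x; z] x y z.
    by rewrite H !eqxx.
  rewrite !(closers_cat, eps_word_cat, emax_word_cat) c e; split=> //.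
  exact: knuth_cat.
- have [|c e k] := @knuth3_signature i (closers i 0 v) [:: x; z; y] [:: z; x; y] x y z.
    by rewrite H !eqxx orbT.
  rewrite !(closers_cat, eps_word_cat, emax_word_cat) c e; split=> //.
  exact: knuth_cat.
Qed.

Lemma knuth_word_string J w1 w2 : knuth w1 w2 -> word_string J w1 = word_string J w2.
Proof.
elim: J w1 w2 => //= i J IH w1 w2 /(knuth_signature i)[_ -> k].
by rewrite (IH _ _ k).
Qed.

(** The inserted letter [x] moves left through the part of the row that exceeds it, up to the letter
    [y] that it will bump. *)
Lemma knuth_bump_right x y v : path leq y v -> x < y ->
  knuth (y :: rcons v x) [:: y, x & v].
Proof.
elim: v y => [|z v IH] y /=; first by move=> _ _; exact: knuth_refl.
move=> /andP[yz pv] xy.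
apply: (@knuth_trans _ [:: y, z, x & v]).
  by have := knuth_cat [:: y] [::] (IH z pv (leq_trans xy yz)); rewrite !cats0.
by apply: (@knuth_yzx [::] v); rewrite xy yz.
Qed.

(** The bumped letter [y] leaves the row on the left, passing each [t] of [u] by a move based on
    [t <= x < y]. *)
Lemma knuth_bump_left x y u v : sorted leq u -> all (geq x) u -> x < y ->
  knuth (u ++ [:: y, x & v]) (y :: u ++ x :: v).
Proof.
elim/last_ind: u x v => [|u t IH] x v /=; first by move=> *; exact: knuth_refl.
rewrite all_rcons => su /andP[tx au] xy; rewrite !cat_rcons.
apply: (@knuth_trans _ (u ++ [:: y, t, x & v])).
  by apply: (@knuth_xzy u v); rewrite xy andbT.
apply: IH; last exact: leq_ltn_trans xy.
  by move: su; rewrite -cats1 => /cat_sorted2[].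
by move: su; rewrite (sorted_pairwise leq_trans) pairwise_rcons => /andP[].
Qed.

Lemma row_bumpP R x (k := find (ltn x) R) : sorted leq R -> k < size R ->
  knuth (rcons R x) (nth 0 R k :: set_nth 0 R k x) /\ sorted leq (set_nth 0 R k x).
Proof.
move=> sR kR; have hasR : has (ltn x) R by rewrite has_find.
have xy : x < nth 0 R k := nth_find 0 hasR.
have ux : all (geq x) (take k R).
  apply/(all_nthP 0) => j; rewrite size_take kR => jk.
  by have := before_find 0 jk; rewrite nth_take //= ltnNge => /negbFE.
have eR : R = take k R ++ nth 0 R k :: drop k.+1 R.
  by rewrite -drop_nth // cat_take_drop.
have eS : set_nth 0 R k x = take k R ++ x :: drop k.+1 R.
  by rewrite set_nthE kR.
move: sR; rewrite {1 2}eR eS; set y := nth 0 R k in xy *.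
move: (take k R) (drop k.+1 R) ux => u v ux {eR eS hasR}.
rewrite (sorted_pairwise leq_trans) pairwise_cat /= => /and3P[auv su /andP[yv pv]].
split.
  rewrite rcons_cat /=; apply: (@knuth_trans _ (u ++ [:: y, x & v])).
    have := knuth_cat u [::] (@knuth_bump_right x y v _ xy); rewrite !cats0; apply.
    by rewrite (path_pairwise leq_trans) /= yv.
  by apply: knuth_bump_left => //; rewrite (sorted_pairwise leq_trans).
rewrite (sorted_pairwise leq_trans) pairwise_cat /= su pv !andbT.
apply/andP; split; last first.
  by apply/allP => t /(allP yv) /= yt; apply: ltnW; exact: leq_trans yt.
apply/allrelP => a b ua; rewrite inE => /orP[/eqP->|bv]; first exact: (allP ux).
by apply: (allrelP auv) => //; rewrite inE bv orbT.
Qed.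

Lemma row_word_cons R T : row_word (R :: T) = row_word T ++ R.
Proof. by rewrite /row_word rev_cons flatten_rcons. Qed.

Lemma row_insertP T x : all (sorted leq) T ->
  knuth (rcons (row_word T) x) (row_word (row_insert T x)) /\
  all (sorted leq) (row_insert T x).
Proof.
elim: T x => [|R T IH] x /=; first by split=> //; exact: knuth_refl.
move=> /andP[sR sT]; case: ifP => kR; last first.
  rewrite !row_word_cons rcons_cat /= sT andbT; split; first exact: knuth_refl.
  rewrite (sorted_pairwise leq_trans) pairwise_rcons -(sorted_pairwise leq_trans).
  rewrite sR andbT; apply/allP => y yR.
  move/negbT: kR; rewrite -has_find => /hasPn/(_ y yR).
  by rewrite /= -leqNgt.
have [k1 s1] := row_bumpP sR kR; have [k2 s2] := IH (nth 0 R (find (ltn x) R)) sT.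
rewrite !row_word_cons rcons_cat /= s1 s2; split=> //.
apply: (@knuth_trans _ (row_word T ++ nth 0 R (find (ltn x) R) ::
                         set_nth 0 R (find (ltn x) R) x)).
  by have := knuth_cat (row_word T) [::] k1; rewrite !cats0.
by have := knuth_cat [::] (set_nth 0 R (find (ltn x) R) x) k2; rewrite cat_rcons.
Qed.

Lemma knuth_insertion_tableau w : knuth w (row_word (insertion_tableau w)).
Proof.
(* The starting tableau is generalized; weakly increasing rows are the invariant on which the
   bumping moves rely. *)
suff H T : all (sorted leq) T ->
    knuth (row_word T ++ w) (row_word (foldl row_insert T w)).
  exact: (H [::]).
elim: w T => [|x w IH] T sT /=; first by rewrite cats0; exact: knuth_refl.
have [k1 s1] := row_insertP x sT.
apply: knuth_trans (IH _ s1); rewrite -cat_rcons.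
exact: (knuth_cat [::] w k1).
Qed.

Lemma string_schutzenberger r J T :
  crystal_string J (schutzenberger r T) =
  word_string J (rev [seq r.+1 - x | x <- row_word T]).
Proof.
rewrite crystal_stringE; apply/esym/knuth_word_string.
exact: knuth_insertion_tableau.
Qed.

(** * Signatures of weakly increasing words *)

Lemma signature_other i c w : all (fun x => (x != i) && (x != i.+1)) w ->
  [/\ closers i c w = c, eps_word i c w = 0 & emax_word i c w = w].
Proof.
elim: w => //= x w IH /andP[/andP[/negPf xi /negPf xi1] /IH[-> -> ->]].
by rewrite xi xi1.
Qed.

Lemma signature_nseq_closer i c n :
  [/\ closers i c (nseq n i) = c + n, eps_word i c (nseq n i) = 0 &
      emax_word i c (nseq n i) = nseq n i].
Proof.
have neq : (i == i.+1) = false by lia.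
by elim: n => [|n [/= -> -> ->]]; rewrite ?addn0 //= eqxx neq addnS.
Qed.

(** The [c] closers on the right match the last openers; those left over stand first and become
    [i]. *)
Lemma signature_nseq_opener i c n :
  [/\ closers i c (nseq n i.+1) = c - n, eps_word i c (nseq n i.+1) = n - c &
      emax_word i c (nseq n i.+1) = nseq (n - c) i ++ nseq (minn n c) i.+1].
Proof.
have neq : (i.+1 == i) = false by lia.
elim: n => [|n [/= -> -> ->]]; first by rewrite subn0 min0n.
rewrite eqxx neq /=; split; [lia| by case: eqP => /=; lia |].
case: (leqP c n) => cn.
  have -> : c - n == 0 by lia.
  by rewrite subSn //= !(minn_idPr _) //; lia.
have -> : (c - n == 0) = false by lia.
have [-> ->] : n - c = 0 /\ n.+1 - c = 0 by lia.
by rewrite !(minn_idPl _) //; lia.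
Qed.

(** * Strings of Gelfand-Tsetlin patterns *)

Section GelfandTsetlinWord.
Variable r : nat.

Definition sorted_word (f : nat -> nat) : seq nat :=
  flatten [seq nseq (f x) x | x <- iota 1 r].

Lemma eq_sorted_word f g : (forall x, 0 < x <= r -> f x = g x) ->
  sorted_word f = sorted_word g.
Proof.
move=> fg; congr flatten; apply/eq_in_map => x; rewrite mem_iota => H.
by rewrite fg //; lia.
Qed.

(** In a weakly increasing word every [i] precedes every [i.+1], so no bracket closes inside the
    word: its openers can only meet the [c] closers from outside. *)
Lemma sorted_word_signature i c f : 0 < i < r ->
  [/\ closers i c (sorted_word f) = c - f i.+1 + f i,
      eps_word i c (sorted_word f) = f i.+1 - c &
      emax_word i c (sorted_word f) =
      sorted_word (fun x => if x == i then f i + (f i.+1 - c)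
                            else if x == i.+1 then minn (f i.+1) c else f x)].
Proof.
move=> ir.
have eI : iota 1 r = iota 1 i.-1 ++ i :: i.+1 :: iota i.+2 (r - i.+1).
  have -> : r = i.-1 + (2 + (r - i.+1)) by lia.
  rewrite iotaD iotaD; have -> : 1 + i.-1 = i by lia.
  by congr (_ ++ _); rewrite /= !addnS addn0; congr [:: _, _ & iota _ _]; lia.
set g := (fun x => if x == i then _ else _).
rewrite /sorted_word eI !map_cat !flatten_cat /=.
have eqg s : {in s, forall x, (x != i) && (x != i.+1)} ->
    [seq nseq (g x) x | x <- s] = [seq nseq (f x) x | x <- s].
  move=> H; apply/eq_in_map => x /H /andP[/negPf xi /negPf xi1].
  by rewrite /g xi xi1.
have other s : {in s, forall x, (x != i) && (x != i.+1)} ->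
    all (fun x => (x != i) && (x != i.+1)) (flatten [seq nseq (f x) x | x <- s]).
  move=> H; apply/allP => x /flattenP[_ /mapP[y ys ->]].
  by rewrite mem_nseq => /andP[_ /eqP->]; exact: H.
have lowP : {in iota 1 i.-1, forall x, (x != i) && (x != i.+1)}.
  by move=> x; rewrite mem_iota; lia.
have highP : {in iota i.+2 (r - i.+1), forall x, (x != i) && (x != i.+1)}.
  by move=> x; rewrite mem_iota; lia.
rewrite !eqg //.
have [gi gi1] : g i = f i + (f i.+1 - c) /\ g i.+1 = minn (f i.+1) c.
  by rewrite /g !eqxx; case: eqP => //; lia.
rewrite gi gi1 !(closers_cat, eps_word_cat, emax_word_cat).
have [hc he hm] := signature_other c (other _ highP); rewrite hc he hm.
have [oc oe om] := signature_nseq_opener i c (f i.+1); rewrite oc oe om.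
have [cc ce cm] := signature_nseq_closer i (c - f i.+1) (f i); rewrite cc ce cm.
have [lc le lm] := signature_other (c - f i.+1 + f i) (other _ lowP).
rewrite lc le lm; split=> //; first by lia.
by rewrite nseqD -!catA.
Qed.

(** The letter x is the complement of the entry q = r + 1 - x, and [a q k] is the length of row k of
    the subtableau of entries at most q. *)
Definition gt_count (a : nat -> nat -> nat) (k x : nat) : nat :=
  a (r.+1 - x) k - a (r - x) k.

Definition gt_word (a : nat -> nat -> nat) (k n : nat) : seq nat :=
  flatten [seq sorted_word (gt_count a j) | j <- iota k n].

Lemma eq_gt_word a b k n : (forall q j, q <= r -> a q j = b q j) ->
  gt_word a k n = gt_word b k n.
Proof.
move=> ab; congr flatten; apply: eq_map => j; apply: eq_sorted_word => x xr.
by rewrite /gt_count !ab //; lia.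
Qed.

(* The complement of a tableau entry q is the letter r + 1 - q, so the openers
   of e_(r - q) are the entries q and the closers the entries q + 1.  Under
   these hypotheses the brackets only match between consecutive rows. *)
Lemma gt_word_signature a q k n :
  0 < q < r ->
  (forall j, a q.-1 j = a q j.+1) ->
  (forall j, a q j <= a q.+1 j) ->
  (forall j, a q.+1 j.+1 <= a q j) ->
  a q.+1 (k + n) = a q (k + n) ->
  [/\ closers (r - q) 0 (gt_word a k n) = a q.+1 k - a q k,
      eps_word (r - q) 0 (gt_word a k n) =
        \sum_(k <= j < k + n) (a q j - a q.+1 j.+1) &
      emax_word (r - q) 0 (gt_word a k n) =
        gt_word (fun p j => if p == q then a q.+1 j.+1 else a p j) k n].
Proof.
move=> qr tail le1 le2; elim: n k => [|n IH] k.
  by rewrite addn0 => ->; rewrite big_geq // subnn.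
rewrite -addSnnS => /IH[]; rewrite /gt_word /=.
rewrite !(closers_cat, eps_word_cat, emax_word_cat) => -> -> ->.
(* The later rows leave [a q.+1 k.+1 - a q k.+1] closers. By [tail], row k has [a q k - a q k.+1]
   openers, which absorb all of them because [a q.+1 k.+1 <= a q k]; the closers of row k itself are
   what remains. *)
have [] := @sorted_word_signature (r - q) (a q.+1 k.+1 - a q k.+1) (gt_count a k).
  by lia.
move=> -> -> ->; rewrite /gt_count.
have [-> -> ->] : [/\ r - (r - q).+1 = q.-1, r.+1 - (r - q).+1 = q &
                     r - (r - q) = q] by split; lia.
have -> : r.+1 - (r - q) = q.+1 by lia.
have := (tail k, le1 k, le1 k.+1, le2 k) => -[[[t l1] l2] l3].
rewrite [\sum_(k <= _ < _) _]big_ltn ?leq_addr //.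
split; [lia| by congr addn; lia |].
congr cat; apply: eq_sorted_word => x xr.
case: (eqVneq x (r - q)) => [->|xq].
  have [-> ->] : r.+1 - (r - q) = q.+1 /\ r - (r - q) = q by lia.
  by rewrite eqxx ifN //; lia.
case: (eqVneq x (r - q).+1) => [->|xq1].
  have [-> ->] : r.+1 - (r - q).+1 = q /\ r - (r - q).+1 = q.-1 by lia.
  by rewrite eqxx ifN; lia.
by rewrite !ifN //; lia.
Qed.

Section Blocks.
Variable a : nat -> nat -> nat.
Hypothesis a0 : forall q j, q <= j -> a q j = 0.
Hypothesis le1 : forall q j, q < r -> a q j <= a q.+1 j.
Hypothesis le2 : forall q j, q < r -> a q.+1 j.+1 <= a q j.

(* The pattern reached after p steps of block m: rows below m are those of a
   lowest weight element. *)
Definition stage (m p q j : nat) : nat :=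
  if m < q then a q j
  else if m - p < q then a m.+1 (j + (m.+1 - q)) else a m (j + (m - q)).

Definition gt_string (m p : nat) : nat :=
  \sum_(0 <= j < r) (a m (j + p) - a m.+1 (j + p).+1).

(** Near index m - p the stage consists of shifts: rows m - p - 1 and m - p come from row m of [a],
    row m - p + 1 from row m + 1. Interlacing of these two rows of [a] supplies the hypotheses of
    [gt_word_signature]. *)
Lemma stage_step m p : p < m < r ->
  eps_word (r - (m - p)) 0 (gt_word (stage m p) 0 r) = gt_string m p /\
  emax_word (r - (m - p)) 0 (gt_word (stage m p) 0 r) = gt_word (stage m p.+1) 0 r.
Proof.
move=> pmr.
have sq j : stage m p (m - p) j = a m (j + p).
  by rewrite /stage ifN ?ifN; [congr a; lia|lia|lia].
have sq' j : stage m p (m - p).-1 j = a m (j.+1 + p).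
  by rewrite /stage ifN ?ifN; [congr a; lia|lia|lia].
have sq1 j : stage m p (m - p).+1 j = a m.+1 (j + p).
  rewrite /stage; case: ifP => H; first by congr a; lia.
  by rewrite ifT; [congr a; lia|lia].
have [|||||_ -> ->] := @gt_word_signature (stage m p) (m - p) 0 r.
- by lia.
- by move=> j; rewrite sq sq'.
- by move=> j; rewrite sq sq1 le1 //; lia.
- by move=> j; rewrite sq sq1 addSn le2 //; lia.
- by rewrite sq sq1 !a0 //; lia.
split; first by apply: eq_bigr => j _; rewrite sq sq1 addSn.
apply: eq_gt_word => q j _; case: (eqVneq q (m - p)) => [->|qmp].
  by rewrite sq1 /stage ifN ?ifT; [congr a; lia|lia|lia].
rewrite /stage; case: ifP => // _.
by have -> : (m - p.+1 < q) = (m - p < q) by lia.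
Qed.

Lemma block_string m p J : p <= m < r ->
  word_string (iota (r - (m - p)) (m - p) ++ J) (gt_word (stage m p) 0 r) =
  [seq gt_string m j | j <- iota p (m - p)] ++
  word_string J (gt_word (stage m m) 0 r).
Proof.
move=> pm; move E: (m - p) => n; elim: n p E pm => [|n IH] p E pm /=.
  by have -> : p = m by lia.
have pmr : p < m < r by lia.
have [] := stage_step pmr; rewrite E => -> ->.
have -> : (r - n.+1).+1 = r - n by lia.
by rewrite IH //; lia.
Qed.

(** The end of block m is the start of block m + 1: at both stages, rows up to m + 1 are shifts of
    row m + 1 of [a]. *)
Lemma blocks_string m n : 0 < m -> m + n <= r ->
  word_string (flatten [seq iota (r - l) l | l <- iota m n])
              (gt_word (stage m 0) 0 r) =
  flatten [seq [seq gt_string l p | p <- iota 0 l] | l <- iota m n].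
Proof.
elim: n m => // n IH m m0 mn; rewrite [iota m n.+1]/= 2!map_cons 2![flatten (_ :: _)]/=.
have := @block_string m 0 (flatten [seq iota (r - l) l | l <- iota m.+1 n]).
rewrite subn0 => ->; last by lia.
rewrite -IH //; last by lia.
congr (_ ++ word_string _ _); apply: eq_gt_word => q j qr.
rewrite /stage subn0; have [qm1|[qm1|qm1]] : q <= m \/ m.+1 < q \/ q = m.+1 by lia.
- have -> : (m.+1 < q) = false by lia.
  have -> : (m < q) = false by lia.
  case: ifP => mq; first by congr a; lia.
  by rewrite !a0 //; lia.
- by rewrite !ifT //; lia.
- by rewrite qm1 ltnSn ltnn; congr a; lia.
Qed.

(** Block 1 starts from [a] itself, since below row 1 there is only the empty row. *)
Lemma J_string : word_string (J_word r) (gt_word a 0 r) =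
  flatten [seq [seq gt_string m p | p <- iota 0 m] | m <- iota 1 r.-1].
Proof.
case: (posnP r) => [r0|r0]; first by rewrite /J_word r0.
rewrite -blocks_string //; last by lia.
congr word_string; apply: eq_gt_word => q j qr.
rewrite /stage; case: (ltngtP 1 q) => [//|q1|<-]; last by congr a; lia.
by rewrite !a0 //; lia.
Qed.

Lemma gt_string_rec m p : m < r ->
  gt_string m p = (a m p - a m.+1 p.+1) + gt_string m p.+1.
Proof.
move=> mr; rewrite /gt_string; case: r mr => // r' mr.
rewrite [in LHS]big_nat_recl // [in RHS]big_nat_recr //= add0n; congr addn.
rewrite [X in _ = _ + X](_ : _ = 0) ?addn0.
  by apply: eq_bigr => j _; rewrite addSnnS.
by rewrite a0 //; lia.
Qed.

Lemma gt_string_last m : m < r -> gt_string m m = 0.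
Proof.
move=> mr; rewrite /gt_string big1 // => j _.
by rewrite a0 //; lia.
Qed.

End Blocks.
End GelfandTsetlinWord.

(** * Circled entries of a pattern *)

Lemma nth_triangle (g : nat -> nat -> nat) n m p : p < m <= n ->
  nth 0 (flatten [seq [seq g l q | q <- iota 0 l] | l <- iota 1 n])
    ((m * m.-1)./2 + p) = g m p.
Proof.
rewrite -bin2.
have sz l : size (flatten [seq [seq g l q | q <- iota 0 l] | l <- iota 1 l]) = 'C(l.+1, 2).
  elim: l => [|l IH] //.
  rewrite -{1}(addn1 l) iotaD map_cat flatten_cat size_cat IH /=.
  by rewrite cats0 size_map size_iota [RHS]binS bin1.
elim: n => [|n IH] H; first by lia.
rewrite -(addn1 n) iotaD map_cat flatten_cat nth_cat sz.
rewrite [flatten [seq _ | _ <- iota (1 + n) 1]](_ : _ = [seq g n.+1 q | q <- iota 0 n.+1]);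
  last by rewrite /= cats0.
case: (ltngtP m n.+1) => mn; [|lia|].
  rewrite ifT ?IH //; first by lia.
  apply: (@leq_trans ('C(m, 2) + m)); first by lia.
  have -> : 'C(m, 2) + m = 'C(m.+1, 2) by rewrite binS bin1.
  by apply: leq_bin2l.
rewrite mn ifN; last by lia.
rewrite addKn (nth_map 0) ?size_iota; last by lia.
by rewrite nth_iota //; lia.
Qed.

(** Reversal puts the top row first; within a row, reversal and complement together keep the letters
    weakly increasing. *)
Lemma rev_complement_tableau r (a : nat -> nat -> nat) :
  rev [seq r.+1 - x | x <- row_word (mkseq (fun k => flatten
        [seq nseq (a m k - a m.-1 k) m | m <- iota 1 r]) r)] = gt_word r a 0 r.
Proof.
rewrite /row_word map_flatten rev_flatten map_rev map_rev revK /mkseq -!map_comp.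
congr flatten; apply: eq_map => k /=.
rewrite map_flatten rev_flatten -!map_rev -!map_comp.
have -> : rev (iota 1 r) = [seq r.+1 - x | x <- iota 1 r].
  apply: (@eq_from_nth _ 0); first by rewrite size_rev size_map.
  rewrite size_rev size_iota => j jr.
  rewrite nth_rev ?size_iota // (nth_map 0) ?size_iota // !nth_iota //; lia.
rewrite -map_comp; congr flatten; apply/eq_in_map => x; rewrite mem_iota => xr /=.
rewrite map_nseq rev_nseq /gt_count.
by congr (nseq (_ - a _ _) _); lia.
Qed.

Section Circled.
Variables (r : nat) (a : nat -> nat -> nat).
Hypothesis a0 : forall q j, q <= j -> a q j = 0.
Hypothesis le1 : forall q j, q < r -> a q j <= a q.+1 j.
Hypothesis le2 : forall q j, q < r -> a q.+1 j.+1 <= a q j.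

Definition gt_tableau : tableau :=
  mkseq (fun k => flatten [seq nseq (a m k - a m.-1 k) m | m <- iota 1 r]) r.

Lemma beta_schutzenberger m p : p < m < r ->
  beta r (schutzenberger r gt_tableau) m p.+1 = gt_string r a m p.
Proof.
move=> H; rewrite /beta string_schutzenberger rev_complement_tableau J_string //.
by rewrite addnS /= nth_triangle //; lia.
Qed.

(** Both clauses of the circling rule compare consecutive values of [gt_string], since
    [gt_string_last] gives 0 beyond the diagonal. By interlacing, the truncated difference vanishes
    only for equal entries. *)
Lemma circled_schutzenberger m p : p < m < r ->
  circled r (schutzenberger r gt_tableau) m p.+1 = (a m p == a m.+1 p.+1).
Proof.
move=> H; have mr : m < r by lia.
have := @le2 m p mr; rewrite /circled; case: eqP => [pm|pm].
  have -> : m = p.+1 by lia.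
  rewrite beta_schutzenberger; last by lia.
  rewrite gt_string_rec // -?pm ?gt_string_last //; lia.
rewrite !beta_schutzenberger; [|lia|lia].
by rewrite [gt_string r a m p]gt_string_rec //; lia.
Qed.

End Circled.

(** * Nondescending products *)

Section NonDescending.
Variable r : nat.
Implicit Types (u : 'S_r) (x y : 'I_r).

Definition nd_step (p : nat) u : 'S_r :=
  let su := perm_comp (simple_refl r p) u in if bruhat_lt u su then su else u.

(** Exchanging two adjacent values affects the relative order of that pair alone, and here the pair
    becomes an inversion. *)
Lemma inversions_simple_lt u x y : y = x.+1 :> nat -> (u^-1)%g x < (u^-1)%g y ->
  inversions u < inversions (perm_comp (tperm x y) u).
Proof.
move=> yx lt; apply: proper_card; apply/properP; split; last first.
  exists ((u^-1)%g x, (u^-1)%g y); rewrite !inE /=.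
    by rewrite /perm_comp !permM !permKV lt tpermL tpermR yx leqnn.
  by rewrite !permKV yx; lia.
apply/subsetP => -[i j]; rewrite !inE /= /perm_comp !permM => /andP[ij uji]; rewrite ij /=.
have notxy : ~~ ((u j == x :> nat) && (u i == y :> nat)).
  apply/negP => /andP[/eqP/val_inj ujx /eqP/val_inj uiy].
  by move: lt; rewrite -ujx -uiy !permK; lia.
have tv z : tperm x y z = (if z == x :> nat then y else if z == y :> nat then x else z).
  by rewrite !val_eqE; case: tpermP => [->|->|/eqP/negPf-> /eqP/negPf->];
    rewrite ?eqxx //; case: eqP => // ->.
rewrite !tv; move: (u i) (u j) uji notxy => ui uj.
by case: ifP; case: ifP; try case: ifP; try case: ifP; lia.
Qed.

Lemma bruhat_lt_inversions u v : bruhat_lt u v -> inversions u < inversions v.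
Proof.
case/andP => uv /connectP[p]; elim: p u uv => [|u1 p IH] u uv /=.
  by move=> _ e; rewrite e eqxx in uv.
move=> /andP[/andP[_ lt1] pp] e; have [e1|n1] := eqVneq u1 v; first by rewrite -e1.
exact: ltn_trans lt1 (IH _ n1 pp e).
Qed.

Lemma bruhat_lt_simple u x y : y = x.+1 :> nat ->
  bruhat_lt u (perm_comp (tperm x y) u) = ((u^-1)%g x < (u^-1)%g y).
Proof.
move=> yx; apply/idP/idP => [/bruhat_lt_inversions lt|lt].
  rewrite ltnNge; apply/negP => le.
  have ne : (u^-1)%g x != (u^-1)%g y.
    by rewrite (inj_eq perm_inj) -val_eqE /= yx; lia.
  have lt' : ((u * tperm x y)^-1)%g x < ((u * tperm x y)^-1)%g y.
    rewrite invMg !permM tpermV tpermL tpermR.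
    by rewrite ltn_neqAle le andbT eq_sym.
  have := inversions_simple_lt yx lt'.
  have -> : perm_comp (tperm x y) (u * tperm x y)%g = u.
    by rewrite /perm_comp -mulgA tperm2 mulg1.
  by rewrite ltnNge ltnW.
have li := inversions_simple_lt yx lt.
apply/andP; split; first by apply: contraTneq li => <-; rewrite ltnn.
apply: connect1; rewrite /bruhat_step li andbT.
(* A Bruhat step multiplies on the other side, so the transposition of values is conjugated into one
   of positions. *)
apply/existsP; exists ((u^-1)%g x); apply/existsP; exists ((u^-1)%g y).
rewrite -tpermJ /perm_comp /conjg invgK; apply/eqP.
by rewrite mulgA mulgKV.
Qed.

(** A permutation is read as a color sequence with color u^-1(n) in place n. Natural places can be
    compared directly with counts of paths. *)
Definition pos u (n : nat) : option 'I_r := omap (u^-1)%g (insub n).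

Lemma posE u x : pos u x = Some ((u^-1)%g x).
Proof. by rewrite /pos valK. Qed.

Lemma pos_some u n : n < r -> pos u n.
Proof. by move=> nr; rewrite -[n]/(val (Ordinal nr)) posE. Qed.

(** The product ascends exactly when [c < d] as indices, that is when place p holds the larger
    color; the exchange then moves it to place p + 1. Otherwise the two places are already
    sorted. *)
Lemma pos_nd_step p u c d : p.+1 < r -> pos u p = Some c -> pos u p.+1 = Some d ->
  [/\ pos (nd_step p.+1 u) p = Some (min_color c d),
      pos (nd_step p.+1 u) p.+1 = Some (max_color c d) &
      forall n, n != p -> n != p.+1 -> pos (nd_step p.+1 u) n = pos u n].
Proof.
move=> pr; have pr' : p < r by lia.
pose x := Ordinal pr'; pose y := Ordinal pr.
rewrite -[p.+1]/(val y) -[p]/(val x) !posE => -[cE] [dE].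
rewrite /nd_step.
have -> : simple_refl r p.+1 = tperm x y.
  by rewrite /simple_refl /= insubT insubT; congr tperm; apply: val_inj.
rewrite (@bruhat_lt_simple u x y) // cE dE /max_color /min_color.
case: ltnP => cd.
  have cd' := ltnW cd; rewrite cd' /perm_comp invMg !permM tpermV tpermL tpermR cE dE.
  split=> // n nx ny; rewrite /pos invMg tpermV.
  case: insubP => //= z _ zn; rewrite permM tpermD // -val_eqE /= zn eq_sym //.
rewrite cE dE; split=> //; case: leqP => // dc; congr Some; apply: val_inj; apply/eqP;
  rewrite /= eqn_leq cd dc //.
Qed.

(** On the reversed list [foldr] applies s_1 first and s_n last, the order in which a row meets the
    paths from left to right. *)
Definition nd_fold u (circ : nat -> bool) (n : nat) : 'S_r :=
  foldr nd_step u [seq p <- rev (iota 1 n) | circ p].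

Lemma nd_foldS u (circ : nat -> bool) n : nd_fold u circ n.+1 =
  if circ n.+1 then nd_step n.+1 (nd_fold u circ n) else nd_fold u circ n.
Proof.
rewrite /nd_fold -{1}(addn1 n) iotaD rev_cat /= add1n.
by case: (circ n.+1).
Qed.

Lemma pos_nd_fold u circ n k : n < r -> n < k ->
  pos (nd_fold u circ n) k = pos u k.
Proof.
elim: n => [|n IH] nr nk //; rewrite nd_foldS; case: ifP => _; last by apply: IH; lia.
have nr' : n < r by lia.
have := pos_some (nd_fold u circ n) nr'; have := pos_some (nd_fold u circ n) nr.
case E1: (pos _ n.+1) => [d|] // _; case E0: (pos _ n) => [c|] // _.
have [_ _ ->] := pos_nd_step nr E0 E1; [|lia|lia].
by apply: IH; lia.
Qed.

End NonDescending.

(** * Rows of the grid *)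

Section Columns.
Variable M : nat.
Implicit Types f g : nat -> bool.

(** Labels decrease from left to right, so this counts the marks in column j and to its left;
    [cnt f j.+1] is the index of a marked column j in [desc f]. *)
Definition cnt f (j : nat) : nat := count f (iota j (M - j)).

Definition desc f : seq nat := filter f (rev (iota 0 M)).

Lemma cntM f : cnt f M = 0.
Proof. by rewrite /cnt subnn. Qed.

Lemma cntS f j : j < M -> cnt f j = f j + cnt f j.+1.
Proof. by move=> jM; rewrite /cnt -subnSK. Qed.

Lemma eq_cnt f g j : (forall l, l < M -> f l = g l) -> cnt f j = cnt g j.
Proof.
move=> fg; apply: eq_in_count => l; rewrite mem_iota => H; apply: fg.
by move: H; lia.
Qed.

Lemma leq_cnt f i j : i <= j <= M -> cnt f j <= cnt f i <= cnt f j + (j - i).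
Proof.
move=> /andP[ij jM]; have -> : i = j - (j - i) by lia.
move: (j - i) (leq_subr i j) => d; elim: d => [|d IH] dj; first by rewrite subn0; lia.
have /IH : d <= j by lia.
rewrite [cnt f (j - d.+1)]cntS; last by lia.
have -> : (j - d.+1).+1 = j - d by lia.
by have := leq_b1 (f (j - d.+1)); lia.
Qed.

Lemma size_desc f : size (desc f) = cnt f 0.
Proof. by rewrite size_filter count_rev /cnt subn0. Qed.

Lemma nth_desc f j : j < M -> f j -> nth 0 (desc f) (cnt f j.+1) = j.
Proof.
move=> jM fj; rewrite /desc.
have -> : iota 0 M = iota 0 j ++ j :: iota j.+1 (M - j.+1).
  have -> : M = j + (M - j.+1).+1 by lia.
  by rewrite iotaD /=; congr (_ ++ _ :: iota _ _); lia.
rewrite rev_cat rev_cons filter_cat filter_rcons fj nth_cat size_rcons.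
rewrite size_filter count_rev -/(cnt f j.+1) ltnSn nth_rcons.
by rewrite size_filter count_rev -/(cnt f j.+1) ltnn eqxx.
Qed.

Lemma uniq_desc f : uniq (desc f).
Proof. by rewrite filter_uniq // rev_uniq iota_uniq. Qed.

Lemma mem_desc f j : (j \in desc f) = f j && (j < M).
Proof. by rewrite mem_filter mem_rev mem_iota. Qed.

Lemma cnt_lt f j : j < M -> f j -> cnt f j.+1 < cnt f 0.
Proof.
move=> jM fj; have /(leq_cnt f) : 0 <= j <= M by lia.
by rewrite cntS // fj; lia.
Qed.

Lemma descP f k (j := nth 0 (desc f) k) : k < cnt f 0 ->
  [/\ j < M, f j & cnt f j.+1 = k].
Proof.
move=> kf; have : j \in desc f by rewrite mem_nth // size_desc.
rewrite mem_desc => /andP[fj jM]; split=> //; apply/eqP.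
rewrite -(nth_uniq 0 _ _ (uniq_desc f)) ?size_desc //; last exact: cnt_lt.
by rewrite nth_desc.
Qed.

Lemma desc_ge f k : k < cnt f 0 -> cnt f 0 - k.+1 <= nth 0 (desc f) k.
Proof.
move=> /descP[jM _ cj]; have /(leq_cnt f) : 0 <= (nth 0 (desc f) k).+1 <= M by lia.
by rewrite cj; lia.
Qed.

End Columns.

(** Conservation leaves six configurations; the implication excludes a vertical - line through a
    vertex with + on both sides. *)
Definition five_vertex (l t r b : bool) : bool := (l + t == r + b) && (b ==> l).

Section UncoloredRow.
Variables (M : nat) (h t b : nat -> bool).
Hypothesis row : forall j, j < M -> five_vertex (h j.+1) (t j) (h j) (b j).
Hypothesis hM : h M = false.

(** Conservation summed from the left boundary: each - entering from above has gone down or crosses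
    to the right of column j. *)
Lemma row_cnt j : j <= M -> cnt M t j = cnt M b j + h j.
Proof.
move=> jM; have -> : j = M - (M - j) by lia.
move: (M - j) (leq_subr j M) => d; elim: d => [|d IH] dM.
  by rewrite subn0 !cntM hM.
have /IH {IH} IH : d <= M by lia.
have lt : M - d.+1 < M by lia.
rewrite cntS // [cnt M b _]cntS //; have := row lt.
have -> : (M - d.+1).+1 = M - d by lia.
by rewrite IH /five_vertex => /andP[/eqP]; lia.
Qed.

Lemma row_bottom j : j < M -> b j -> cnt M t j.+1 = (cnt M b j.+1).+1.
Proof.
move=> jM bj; rewrite row_cnt //; have := row jM; rewrite /five_vertex bj /=.
by case/andP => _ ->; rewrite addn1.
Qed.

Lemma row_interlacing n : n < cnt M b 0 -> n.+1 < cnt M t 0 ->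
  nth 0 (desc M b) n < nth 0 (desc M t) n /\
  nth 0 (desc M t) n.+1 <= nth 0 (desc M b) n.
Proof.
move=> nb nt; have [jM bj cj] := descP nb; have ct := row_bottom jM bj.
have [j1M _ c1] := descP (ltnW nt); have [j2M t2 c2] := descP nt.
set j := nth 0 (desc M b) n in jM bj cj ct *.
set j1 := nth 0 _ n in j1M c1 *; set j2 := nth 0 _ n.+1 in j2M t2 c2 *.
split; [rewrite ltnNge|rewrite leqNgt]; apply/negP => le.
  have /(leq_cnt t) : j1.+1 <= j.+1 <= M by lia.
  by lia.
have /(leq_cnt t) : j.+1 <= j2 <= M by lia.
by rewrite [cnt M t j2]cntS // t2; lia.
Qed.

(** By [row_bottom], a - below column j has exactly n others to its left in the lower row, so it
    must be entry n of that row. *)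
Lemma row_crossing j n : j < M -> t j -> cnt M t j.+1 = n.+1 -> n < cnt M b 0 ->
  b j = (nth 0 (desc M b) n == nth 0 (desc M t) n.+1).
Proof.
move=> jM tj cj nb; rewrite -cj nth_desc //; apply/idP/eqP => [bj|<-].
  have := row_bottom jM bj; rewrite cj => -[->]; exact: nth_desc.
by have [] := descP nb.
Qed.

End UncoloredRow.

(** * Transport of colors along a row *)

Section ColoredRow.
Variables (r M : nat) (H T B : nat -> option 'I_r).
Hypothesis row : forall j, j < M -> colored_vertex (H j.+1) (T j) (H j) (B j).
Hypothesis HM : H M = None.

Let cntT := cnt M (fun j => isSome (T j)).
Let cntB := cnt M (fun j => isSome (B j)).

Lemma colored_five_vertex j : j < M ->
  five_vertex (isSome (H j.+1)) (isSome (T j)) (isSome (H j)) (isSome (B j)).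
Proof. by move=> /row[]. Qed.

Lemma colored_row_cnt j : j <= M -> cntT j = cntB j + isSome (H j).
Proof.
apply: (@row_cnt M (fun l => isSome (H l))); first exact: colored_five_vertex.
by rewrite HM.
Qed.

Variables (u : 'S_r) (circ : nat -> bool).
Hypothesis cntT_le : cntT 0 <= r.
Hypothesis topE : forall j, j < M -> T j -> T j = pos u (cntT j.+1).
Hypothesis circE : forall j n, j < M -> T j -> cntT j.+1 = n.+1 ->
  circ n.+1 = isSome (B j).

(** Scanning from the left, after k top paths the circled steps among s_1, ..., s_(k-1) have acted.
    Bottom edges occupy the first places and the carried color place k - 1. For k = 0 the
    predecessor is 0 and the fold is still [u]. *)
Lemma colored_row_invariant j : j <= M ->
  (H j -> H j = pos (nd_fold u circ (cntT j).-1) (cntT j).-1) /\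
  (forall l, j <= l < M -> B l -> B l = pos (nd_fold u circ (cntT j).-1) (cntB l.+1)).
Proof.
move=> jM; have -> : j = M - (M - j) by lia.
move: (M - j) (leq_subr j M) => d; elim: d => [|d IH] dM.
  by rewrite subn0 HM; split=> // l; lia.
have /IH {IH} : d <= M by lia.
move: dM; set j0 := M - d.+1 => dM.
have jS : M - d = j0.+1 by lia.
have j0M : j0 < M by lia.
rewrite jS => -[carry bots].
have nle : cntT j0 <= r.
  have /(leq_cnt (fun j => isSome (T j))) : 0 <= j0 <= M by lia.
  by rewrite -/(cntT 0) -/(cntT j0); lia.
have cT : cntT j0 = T j0 + cntT j0.+1 := cntS _ j0M.
have cB : cntB j0 = B j0 + cntB j0.+1 := cntS _ j0M.
have cc := colored_row_cnt j0M.
have tE := topE j0M; have cE := @circE j0 (cntT j0.+1).-1 j0M.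
have botlt l : j0.+1 <= l < M -> B l -> cntB l.+1 < cntB j0.+1.
  move=> lj Bl; have lM : l < M by lia.
  have /(leq_cnt (fun j => isSome (B j))) : j0.+1 <= l <= M by lia.
  by rewrite [cnt _ _ l]cntS // Bl -/(cntB _) -/(cntB _); lia.
have splitl l : j0 <= l < M -> l = j0 \/ j0.+1 <= l < M by lia.
have := row j0M.
move Eh1: (H j0.+1) carry cc => h1 carry cc; move Et: (T j0) tE cE cT => t1 tE cE cT.
move Eh: (H j0) => h0; move Eb: (B j0) cE cB => b0 cE cB V.
case: V Eh1 Et Eh Eb carry tE cE cT cB cc => [|c d'|c|c|c] Eh1 Et Eh Eb;
  rewrite /= ?add0n ?add1n ?addn0 ?addn1 => carry tE cE cT cB cc; rewrite ?cT.
- split=> // l /splitl[->|]; [by rewrite Eb|exact: bots].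
(* All four edges are colored: the carried color is in place p, the entering one in place p + 1,
   untouched so far. The bottom edge makes s_(p+1) circled, and it sorts the two. *)
- have n0 : cntT j0.+1 = (cntT j0.+1).-1.+1 by rewrite cc.
  have := carry isT; have := tE isT; have := cE isT n0.
  rewrite cc /= nd_foldS => -> /esym top /esym car.
  have lt : (cntB j0.+1).+1 < r by lia.
  have top' : pos (nd_fold u circ (cntB j0.+1)) (cntB j0.+1).+1 = Some d'.
    by rewrite pos_nd_fold //; lia.
  have [p1 p2 p3] := pos_nd_step lt car top'.
  split=> [_|l /splitl[->|lj Bl]]; [by rewrite p2|by rewrite Eb p1|].
  have blt := botlt _ lj Bl; rewrite p3; [|lia|lia].
  by rewrite bots // cc.
- by split=> // l /splitl[->|]; [rewrite Eb|exact: bots].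
- split=> // l /splitl[-> _|]; last exact: bots.
  by rewrite Eb carry // cc.
(* A path enters from above with nothing carried. The first path has no reflection attached; for a
   later one the empty bottom edge means that its reflection is not circled. *)
- have [z|nz] := posnP (cntT j0.+1).
    have bz : cntB j0.+1 = 0 by lia.
    split=> [_|l /splitl[->|lj Bl]]; [by rewrite tE // z|by rewrite Eb|].
    by have := botlt _ lj Bl; lia.
  have n0 : cntT j0.+1 = (cntT j0.+1).-1.+1 by lia.
  have fE : nd_fold u circ (cntT j0.+1) = nd_fold u circ (cntT j0.+1).-1.
    by rewrite n0 nd_foldS cE.
  split=> [_|l /splitl[->|lj Bl]]; last by rewrite fE; exact: bots.
    by rewrite tE // fE pos_nd_fold //; lia.
  by rewrite Eb.
Qed.

End ColoredRow.

(** * Reconstruction of colors from spins *)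

Definition color_right r (l t : option 'I_r) (h : bool) : option 'I_r :=
  match l, t with
  | Some c, Some d => Some (max_color c d)
  | Some c, None => if h then Some c else None
  | None, _ => t
  end.

Definition color_bottom r (l t : option 'I_r) (h : bool) : option 'I_r :=
  match l, t with
  | Some c, Some d => Some (min_color c d)
  | Some c, None => if h then None else Some c
  | None, _ => None
  end.

(** The left and top edges determine the vertex except for a color on the left and + on top, where
    the spin [h] of the right edge decides between going straight and turning down. *)
Lemma color_vertexP r (l t : option 'I_r) (h b : bool) :
  five_vertex (isSome l) (isSome t) h b ->
  [/\ colored_vertex l t (color_right l t h) (color_bottom l t h),
      isSome (color_right l t h) = h & isSome (color_bottom l t h) = b].
Proof.
by case: l => [c|]; case: t => [d|]; case: h; case: b => //= _; split=> //;
  constructor.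
Qed.

Section ColorRow.
Variables (r M : nat) (T : nat -> option 'I_r) (h t b : nat -> bool).

(* The edge to the right of column M - d. *)
Fixpoint color_carry (d : nat) : option 'I_r :=
  if d is d'.+1 then color_right (color_carry d') (T (M - d)) (h (M - d)) else None.

Definition color_row (j : nat) : option 'I_r := color_carry (M - j).

Lemma color_rowS j : j < M ->
  color_row j = color_right (color_row j.+1) (T j) (h j).
Proof.
move=> jM; rewrite /color_row -subnSK //=.
by have -> : M - (M - j.+1).+1 = j by lia.
Qed.

Hypothesis row : forall j, j < M -> five_vertex (h j.+1) (t j) (h j) (b j).
Hypothesis hM : h M = false.
Hypothesis Tt : forall j, j < M -> isSome (T j) = t j.

Lemma color_row_some j : j <= M -> isSome (color_row j) = h j.
Proof.
move=> jM; have -> : j = M - (M - j) by lia.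
move: (M - j) (leq_subr j M) => d; elim: d => [|d IH] dM.
  by rewrite subn0 /color_row subnn hM.
have lt : M - d.+1 < M by lia.
have /IH {IH} IH : d <= M by lia.
have := row lt; rewrite color_rowS // -Tt // subnSK // -IH.
by case/color_vertexP.
Qed.

Lemma color_row_vertex j : j < M ->
  colored_vertex (color_row j.+1) (T j) (color_row j)
                 (color_bottom (color_row j.+1) (T j) (h j)) /\
  isSome (color_bottom (color_row j.+1) (T j) (h j)) = b j.
Proof.
move=> jM; rewrite (color_rowS jM).
have := row jM; rewrite -Tt // -{1}color_row_some //.
by case/color_vertexP.
Qed.

End ColorRow.

Section EdgesNat.
Variables (E : Type) (r N : nat) (s : state E r N).

Definition vert (i j : nat) : E := vedge s (inord i) (inord j).
Definition horiz (i : 'I_r) (j : nat) : E := hedge s i (inord j).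

Lemma edgesE (i : 'I_r) j : j < N.+1 ->
  [/\ left_edge s i (inord j) = horiz i j.+1,
      top_edge s i (inord j) = vert i j,
      right_edge s i (inord j) = horiz i j &
      bottom_edge s i (inord j) = vert i.+1 j].
Proof.
move=> jN; have := ltn_ord i => ir.
by split; congr (fun_of_matrix _ _ _); apply: val_inj;
  rewrite /= /bump ?add1n !inordK //; lia.
Qed.

End EdgesNat.

Lemma desc_sorted M f : sorted gtn (desc M f).
Proof.
apply: sorted_filter; first by move=> y x z /= xy yz; exact: ltn_trans yz xy.
by rewrite rev_sorted; exact: iota_ltn_sorted.
Qed.

(** * States *)

Section UncoloredState.
Variables (r N : nat) (lam : r.-tuple nat) (s : state spin r N).
Hypothesis lam_sorted : sorted geq lam.
Hypothesis lam_bound : head 0 lam + r - 1 <= N.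
Hypothesis sP : uncolored_state lam s.

Definition minus_vert (i j : nat) : bool := is_minus (vert s i j).
Definition minus_horiz (i : 'I_r) (j : nat) : bool := is_minus (horiz s i j).

Lemma uncolored_row (i : 'I_r) j : j < N.+1 ->
  five_vertex (minus_horiz i j.+1) (minus_vert i j) (minus_horiz i j)
              (minus_vert i.+1 j).
Proof.
move=> jN; have [_ _ _ _ /(_ i (inord j))] := sP.
have [-> -> -> ->] := edgesE s i jN; rewrite /minus_horiz /minus_vert.
by case.
Qed.

Lemma minus_horiz_left (i : 'I_r) : minus_horiz i N.+1 = false.
Proof.
have [_ /(_ i) H _ _ _] := sP; rewrite /minus_horiz /horiz.
by rewrite (_ : inord _ = ord_max) ?H //; apply: val_inj; rewrite /= inordK.
Qed.

Lemma minus_horiz_right (i : 'I_r) : minus_horiz i 0.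
Proof.
have [_ _ _ /(_ i) H _] := sP; rewrite /minus_horiz /horiz.
by rewrite (_ : inord _ = ord0) ?H //; apply: val_inj; rewrite /= inordK.
Qed.

Lemma minus_vert_top j : j < N.+1 ->
  minus_vert 0 j = [exists k, j == top_column lam k].
Proof.
move=> jN; have [/(_ (inord j)) H _ _ _ _] := sP; rewrite /minus_vert /vert.
rewrite (_ : inord 0 = ord0); last by apply: val_inj; rewrite /= inordK.
by rewrite H inordK //; case: [exists _, _].
Qed.

Lemma minus_columnsE i : minus_columns s (inord i) = desc N.+1 (minus_vert i).
Proof.
rewrite /minus_columns /desc -val_enum_ord -map_rev filter_map.
congr map; apply: eq_filter => j /=.
by rewrite /minus_vert /vert inord_val.
Qed.

Lemma top_column_lt (k l : 'I_r) : k < l -> top_column lam l < top_column lam k.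
Proof.
move=> kl; rewrite /top_column !(tnth_nth 0).
have geqT : transitive geq by move=> y x z /= xy yz; exact: leq_trans yz xy.
have := @sorted_leq_nth _ geq geqT leqnn 0 _ lam_sorted k l.
rewrite !inE !size_tuple !ltn_ord => /(_ isT isT (ltnW kl)) /=.
by have := ltn_ord l; lia.
Qed.

Lemma top_column_bound (k : 'I_r) : top_column lam k < N.+1.
Proof.
have r0 : 0 < r by case: r k => // -[].
pose k0 := Ordinal r0.
have : top_column lam k <= top_column lam k0.
  have [/eqP|k1] := posnP k; last by rewrite ltnW // top_column_lt.
  by rewrite -[0]/(val k0) val_eqE => /eqP->.
rewrite {2}/top_column (tnth_nth 0) /= nth0; move: lam_bound; lia.
Qed.

(** Two strictly decreasing lists with the same elements coincide. *)
Lemma top_columns : desc N.+1 (minus_vert 0) = [seq top_column lam k | k <- enum 'I_r].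
Proof.
have gtT : transitive gtn by move=> y x z /= xy yz; exact: ltn_trans yz xy.
apply: (irr_sorted_eq gtT) => [x|||x]; first exact: ltnn.
- exact: desc_sorted.
- rewrite sorted_map; apply: (@sub_sorted _ (relpre val ltn)).
    by move=> k l; exact: top_column_lt.
  by rewrite -sorted_map val_enum_ord; exact: iota_ltn_sorted.
- rewrite mem_desc; apply/andP/mapP => [[mx xN]|[k _ ->]].
    by move: mx; rewrite minus_vert_top // => /existsP[k /eqP->];
      exists k; rewrite ?mem_enum.
  rewrite top_column_bound minus_vert_top ?top_column_bound //; split=> //.
  by apply/existsP; exists k.
Qed.

Lemma cnt_top : cnt N.+1 (minus_vert 0) 0 = r.
Proof. by rewrite -size_desc top_columns size_map size_enum_ord. Qed.

Lemma cnt_minus i : i <= r -> cnt N.+1 (minus_vert i) 0 = r - i.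
Proof.
elim: i => [|i IH] ir; first by rewrite cnt_top subn0.
have := row_cnt (@uncolored_row (Ordinal ir)) (minus_horiz_left _) (leq0n _).
by rewrite /= IH ?minus_horiz_right; lia.
Qed.

(** Color k starts in place k, so the first color sequence is the identity permutation. *)
Lemma cnt_top_column (k : 'I_r) : cnt N.+1 (minus_vert 0) (top_column lam k).+1 = k.
Proof.
have tN := top_column_bound k.
have mt : minus_vert 0 (top_column lam k).
  by rewrite minus_vert_top //; apply/existsP; exists k.
apply/eqP; rewrite -(nth_uniq 0 _ _ (uniq_desc N.+1 (minus_vert 0))).
- rewrite nth_desc // top_columns (nth_map k) ?size_enum_ord //.
  by rewrite nth_ord_enum.
- by rewrite size_desc; exact: cnt_lt.
- by rewrite size_desc cnt_top.
Qed.

Let a m k := nth 0 (subshape s m) k.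

Lemma subshapeE m k : m <= r ->
  a m k = if k < m then nth 0 (desc N.+1 (minus_vert (r - m))) k - (m - k.+1) else 0.
Proof.
move=> mr; rewrite /a /subshape /gt_row minus_columnsE inordK ?ltnS ?leq_subr //.
have -> : r - (r - m) = m by lia.
case: ltnP => km; last by rewrite nth_default // size_mkseq.
by rewrite nth_mkseq //; congr subn; lia.
Qed.

Lemma subshape0 m k : m <= k -> a m k = 0.
Proof.
move=> mk; rewrite /a /subshape /gt_row nth_default // size_mkseq.
by rewrite inordK ?ltnS ?leq_subr //; lia.
Qed.

(** The last bound makes the truncated subtractions of [gt_row] exact; the strict inequality between
    columns then becomes a weak one between pattern entries. *)
Lemma subshape_interlacing m k : k < m < r ->
  let A := nth 0 (desc N.+1 (minus_vert (r - m.+1))) in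
  let B := nth 0 (desc N.+1 (minus_vert (r - m))) in
  [/\ B k < A k, A k.+1 <= B k & m - k.+1 <= A k.+1].
Proof.
move=> kmr /=; have ir : r - m.+1 < r by lia.
have eS : (r - m.+1).+1 = r - m by lia.
have := row_interlacing (@uncolored_row (Ordinal ir)) (minus_horiz_left _) (n := k).
rewrite /= eS !cnt_minus; [|lia|lia].
have -> : r - (r - m) = m by lia.
have -> : r - (r - m.+1) = m.+1 by lia.
case; [lia|lia|] => lt1 lt2; split=> //.
have := @desc_ge N.+1 (minus_vert (r - m.+1)) k.+1.
by rewrite cnt_minus; lia.
Qed.

Lemma subshape_le1 m k : m < r -> a m k <= a m.+1 k.
Proof.
move=> mr; case: (ltnP k m) => km; last by rewrite subshape0.
have kmr : k < m < r by lia.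
have [] := subshape_interlacing kmr; rewrite !subshapeE; [|lia|lia].
by rewrite km ltnS (ltnW km); lia.
Qed.

Lemma subshape_le2 m k : m < r -> a m.+1 k.+1 <= a m k.
Proof.
move=> mr; case: (ltnP k m) => km; last by rewrite subshape0.
have kmr : k < m < r by lia.
have [] := subshape_interlacing kmr; rewrite !subshapeE; [|lia|lia].
by rewrite km ltnS km; lia.
Qed.

(** The entries [a m n] and [a m.+1 n.+1] subtract the same offset m - n - 1 from their columns, so
    they agree exactly when the columns do, which [row_crossing] relates to the edge below. *)
Lemma circled_crossing (i : 'I_r) j n (m := r - i.+1) : j < N.+1 ->
  minus_vert i j -> cnt N.+1 (minus_vert i) j.+1 = n.+1 ->
  circled r (schutzenberger r (state_tableau s)) m n.+1 = minus_vert i.+1 j.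
Proof.
move=> jN mj cj; have ir := ltn_ord i.
have nm : n < m.
  by have := cnt_lt jN mj; rewrite cj cnt_minus; lia.
have nmr : n < m < r by lia.
rewrite (circled_schutzenberger subshape0 subshape_le1 subshape_le2) //.
have := row_crossing (@uncolored_row i) (minus_horiz_left i) jN mj cj.
rewrite cnt_minus // => -> //.
have [] := subshape_interlacing nmr; rewrite -/(a _ _) -/(a _ _) !subshapeE; [|lia|lia].
have -> : r - m = i.+1 by lia.
have -> : r - m.+1 = i by lia.
by rewrite ltnS nm; lia.
Qed.

End UncoloredState.

(** * Colorings of an uncolored state *)

Section ColoredState.
Variables (r N : nat) (lam : r.-tuple nat) (s : state spin r N).
Hypothesis lam_sorted : sorted geq lam.
Hypothesis lam_bound : head 0 lam + r - 1 <= N.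
Hypothesis sP : uncolored_state lam s.

Lemma forget_color_some (x : option 'I_r) : is_minus (forget_color x) = isSome x.
Proof. by case: x. Qed.

Let T' := schutzenberger r (state_tableau s).

(* The permutation reached after the first i rows: row i of the grid is block
   m = r - 1 - i of the circled reflections. *)
Definition partial_omega (i : nat) : 'S_r :=
  foldr (@nd_step r) 1%g
    (flatten [seq [seq p <- rev (iota 1 m) | circled r T' m p] | m <- iota (r - i) i]).

Lemma partial_omegaS i : i < r -> partial_omega i.+1 =
  nd_fold (partial_omega i) (circled r T' (r - i.+1)) (r - i.+1).
Proof. by move=> ir; rewrite /partial_omega /= foldr_cat subnSK. Qed.

Lemma partial_omega_last : 0 < r -> partial_omega r = omega r T'.
Proof.
move=> r0; rewrite /partial_omega subnn /omega /circled_refls /Pi_nd.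
(* The last row of the grid is block 0, which contributes no reflection. *)
have -> // : iota 0 r = 0 :: iota 1 r.-1.
by case: r r0.
Qed.

(** No right boundary is assumed, so this applies both to a given colored state and to the coloring
    constructed from [s]. *)
Lemma colored_right_boundary (t : state (option 'I_r) r N) :
  (forall j, vedge t ord0 j = [pick k | (j : nat) == top_column lam k]) ->
  (forall i j, colored_vertex (left_edge t i j) (top_edge t i j)
                              (right_edge t i j) (bottom_edge t i j)) ->
  forget_colors t = s ->
  forall k, hedge t k ord0 =
    Some ((perm_comp (longest r) (omega r T'))^-1%g k).
Proof.
move=> ttop tvert ts.
have vs i j : isSome (vert t i j) = minus_vert s i j.
  by rewrite /minus_vert /vert -ts mxE forget_color_some.
have hs i j : isSome (horiz t i j) = minus_horiz s i j.
  by rewrite /minus_horiz /horiz -ts mxE forget_color_some.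
have trow (i : 'I_r) j : j < N.+1 ->
    colored_vertex (horiz t i j.+1) (vert t i j) (horiz t i j) (vert t i.+1 j).
  by move=> jN; have := tvert i (inord j); have [-> -> -> ->] := edgesE t i jN.
have tleft i : horiz t i N.+1 = None.
  by have := hs i N.+1; rewrite (minus_horiz_left sP); case: (horiz t i N.+1).
have cntE i j : cnt N.+1 (fun l => isSome (vert t i l)) j = cnt N.+1 (minus_vert s i) j.
  by apply: eq_cnt => l _; exact: vs.
have cntm := cnt_minus lam_sorted lam_bound sP.
(* After i rows, [partial_omega i] lists the colors of the current vertical edges, followed by those
   that have left through the right boundary, the latest exit first. *)
have main i : i <= r ->
  (forall j, j < N.+1 -> vert t i j ->
     vert t i j = pos (partial_omega i) (cnt N.+1 (minus_vert s i) j.+1)) /\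
  (forall k : 'I_r, k < i -> horiz t k 0 = pos (partial_omega i) (r - k.+1)).
  elim: i => [|i IH] ir.
    split=> // j jN; rewrite /vert (_ : inord 0 = ord0); last first.
      by apply: val_inj; rewrite /= inordK.
    rewrite ttop inordK //; case: pickP => // k /eqP-> _.
    rewrite (cnt_top_column lam_sorted lam_bound sP).
    by rewrite /partial_omega /= posE invg1 perm1.
  have [verts exits] := IH (ltnW ir).
  pose i' := Ordinal ir.
  have cle : cnt N.+1 (fun l => isSome (vert t i l)) 0 <= r by rewrite cntE cntm; lia.
  have tops j : j < N.+1 -> vert t i j -> vert t i j =
      pos (partial_omega i) (cnt N.+1 (fun l => isSome (vert t i l)) j.+1).
    by rewrite cntE; exact: verts.
  have circs j n : j < N.+1 -> vert t i j ->
      cnt N.+1 (fun l => isSome (vert t i l)) j.+1 = n.+1 ->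
      circled r T' (r - i.+1) n.+1 = isSome (vert t i.+1 j).
    rewrite cntE !vs => jN vj cj.
    exact: (circled_crossing lam_sorted lam_bound sP (i := i')).
  have := colored_row_invariant (trow i') (tleft i') cle tops circs (leq0n _).
  rewrite cntE cntm ?(ltnW ir) //.
  have -> : (r - i).-1 = r - i.+1 by lia.
  rewrite -partial_omegaS // => -[ex bot]; split=> [j jN vj|k].
    by rewrite bot // cntE.
  rewrite ltnS leq_eqVlt => /orP[/eqP ki|ki].
    have -> : k = i' by apply: val_inj.
    by rewrite ex // hs (minus_horiz_right sP).
  (* Row i only acts on places up to r - i - 1, and earlier exits occupy higher ones. *)
  rewrite exits // partial_omegaS // pos_nd_fold //; lia.
move=> k; have [_ exits] := main r (leqnn _).
have r0 : 0 < r by have := ltn_ord k; lia.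
have := exits k (ltn_ord k); rewrite /horiz (_ : inord 0 = ord0); last first.
  by apply: val_inj; rewrite /= inordK.
(* Place r - k - 1 is the image of k under the involution w_0, whence the factor w_0. *)
move=> ->; rewrite -[r - k.+1]/(val (rev_ord k)) posE partial_omega_last //.
congr Some; rewrite /perm_comp invMg permM; congr (_ _).
by apply: (@perm_inj _ (longest r)); rewrite permKV permE rev_ordK.
Qed.

Definition minus_horiz_nat (i j : nat) : bool :=
  oapp (fun i' => minus_horiz s i' j) false (insub i).

Fixpoint color_vert (i j : nat) : option 'I_r :=
  if i is i'.+1 then
    color_bottom (color_row N.+1 (color_vert i') (minus_horiz_nat i') j.+1)
                 (color_vert i' j) (minus_horiz_nat i' j)
  else [pick k | j == top_column lam k].

Definition color_horiz (i j : nat) : option 'I_r :=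
  color_row N.+1 (color_vert i) (minus_horiz_nat i) j.

Definition coloring : state (option 'I_r) r N :=
  State (\matrix_(i, j) color_vert i j) (\matrix_(i, j) color_horiz i j).

Lemma minus_horiz_natE (i : 'I_r) j : minus_horiz_nat i j = minus_horiz s i j.
Proof. by rewrite /minus_horiz_nat valK. Qed.

Lemma minus_nat_row (i : 'I_r) j : j < N.+1 ->
  five_vertex (minus_horiz_nat i j.+1) (minus_vert s i j) (minus_horiz_nat i j)
              (minus_vert s i.+1 j).
Proof. by move=> jN; rewrite !minus_horiz_natE; exact: (uncolored_row sP). Qed.

Lemma minus_nat_left (i : 'I_r) : minus_horiz_nat i N.+1 = false.
Proof. by rewrite minus_horiz_natE (minus_horiz_left sP). Qed.

Lemma color_vert_some i j : i <= r -> j < N.+1 ->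
  isSome (color_vert i j) = minus_vert s i j.
Proof.
elim: i j => [|i IH] j ir jN /=.
  rewrite (minus_vert_top sP) //; case: pickP => [k jk|none].
    by apply/esym/existsP; exists k.
  by apply/esym/existsP => -[k]; rewrite none.
have [] := color_row_vertex (@minus_nat_row (Ordinal ir))
  (minus_nat_left _) (fun l lN => IH l (ltnW ir) lN) jN.
by [].
Qed.

Lemma color_horiz_some (i : 'I_r) j : j <= N.+1 ->
  isSome (color_horiz i j) = minus_horiz s i j.
Proof.
move=> jN; rewrite -minus_horiz_natE.
apply: (color_row_some (@minus_nat_row i) (minus_nat_left i)) => // l lN.
by apply: color_vert_some => //; exact: ltnW.
Qed.

Lemma forget_coloring : forget_colors coloring = s.
Proof.
have minus_inj : injective is_minus by case=> [] [].
have vE (i : 'I_r.+1) (j : 'I_N.+1) :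
    forget_color (color_vert i j) = vedge s i j.
  apply: minus_inj; rewrite forget_color_some color_vert_some //; last by rewrite -ltnS.
  by rewrite /minus_vert /vert !inord_val.
have hE (i : 'I_r) (j : 'I_N.+2) : forget_color (color_horiz i j) = hedge s i j.
  apply: minus_inj; rewrite forget_color_some color_horiz_some; last by rewrite -ltnS.
  by rewrite /minus_horiz /horiz inord_val.
rewrite /forget_colors /coloring /=; case: s vE hE => v h /= vE hE.
by congr State; apply/matrixP => i j; rewrite !mxE.
Qed.

Lemma coloring_top j : vedge coloring ord0 j = [pick k | (j : nat) == top_column lam k].
Proof. by rewrite mxE. Qed.

Lemma coloring_vertex i j :
  colored_vertex (left_edge coloring i j) (top_edge coloring i j)
                 (right_edge coloring i j) (bottom_edge coloring i j).
Proof.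
rewrite /left_edge /top_edge /right_edge /bottom_edge !mxE /= /bump /= !add1n.
have Tt l : l < N.+1 -> isSome (color_vert i l) = minus_vert s i l.
  by apply: color_vert_some; exact: ltnW.
by have [] := color_row_vertex (@minus_nat_row i) (minus_nat_left i) Tt (ltn_ord j).
Qed.

(** The left and bottom boundaries come from the spins of [s], since only [None] is sent to +; the
    right boundary is the only place where [w] enters. *)
Lemma coloring_state (w : 'S_r) :
  (forall k, hedge coloring k ord0 = Some ((w^-1)%g k)) -> colored_state lam w coloring.
Proof.
have [_ sleft sbot _ _] := sP; have fc := forget_coloring.
have none (x : option 'I_r) : forget_color x = Plus -> x = None by case: x.
move=> right; split=> //.
- exact: coloring_top.
- by move=> i; apply: none; rewrite -(sleft i) -fc [RHS]mxE.
- by move=> j; apply: none; rewrite -(sbot j) -fc [RHS]mxE.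
- exact: coloring_vertex.
Qed.

End ColoredState.

Theorem theorem6p1 (r N : nat) (lam : r.-tuple nat)
    (R : realType) (z : 'I_r -> complex R) (w : 'S_r) (s : state spin r N) :
  2 <= r ->
  sorted geq lam ->
  head 0 lam + r - 1 <= N ->
  (forall k, z k != 0%R) ->
  uncolored_state lam s ->
  (exists t : state (option 'I_r) r N,
      colored_state lam w t /\ forget_colors t = s)
  <-> perm_comp (longest r) (omega r (schutzenberger r (state_tableau s))) = w.
Proof.
move=> _ ls lb _ sP; split=> [[t [[ttop _ _ tright tvert] ts]]|<-].
  (* The right boundary of [t] spells out the inverse of [w], and the forced colors spell out the
     inverse of the product. *)
  apply: invg_inj; apply/permP => k; apply/esym.
  have := colored_right_boundary ls lb sP ttop tvert ts k.
  by rewrite tright => -[].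
exists (coloring lam s); split; last exact: forget_coloring.
apply: coloring_state => //.
exact: colored_right_boundary (coloring_top _ _) (coloring_vertex sP) (forget_coloring sP).
Qed.
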